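(* Let $V=\bigoplus_{n>0}V_n$ be a locally finite positively graded vector space and let $X$ be the derived moduli stack of graded algebra structures on $V$ (given by the bundle of curved differential graded Lie algebras $(\mathscr L,f,d^\mu,[\,,])$ on $M=[L^1/G]$). Let $P$ be the point of $X$ represented by an associative graded product $\mu\in L^1$, i.e. by the graded algebra $(V,\mu)$. Then the tangent complex of $X$ at $P$ is the complex $(L,d^\mu)$ with $d^\mu=[\mu,\cdot\,]$, which is the shifted Hochschild cochain complex of $(V,\mu)$ with cochains homogeneous of degree zero; hence $$H^i(\mathbb T_X|_P)=H\!H^{i+1}_{\mathrm{gr}}(V,\mu)\qquad\text{for all } i\ge0 .$$
   Context: The ground field $\mathbb C$ is a field of characteristic zero. Locally finite means that each $V_n$ is finite dimensional. $L=\bigoplus_{p\ge0}L^p$ with $L^p=\mathrm{Hom}_{\mathrm{gr}}(V^{\otimes(p+1)},V)$ (degree preserving multilinear maps), with product $(\mu\circ\nu)(a_0,\ldots,a_{p+q})=\sum_{i=0}^p(-1)^{iq}\mu(a_0,\ldots,\nu(a_i,\ldots,a_{i+q}),\ldots,a_{p+q})$ for $\mu\in L^p,\nu\in L^q$ and Gerstenhaber bracket $[\mu,\nu]=\mu\circ\nu-(-1)^{pq}\nu\circ\mu$. The gauge group $G=\prod_nGL(V_n)$, with Lie algebra $L^0$, acts on $L$ by conjugation. On $L^1$ there is the $G$-equivariant bundle of curved differential graded Lie algebras $\mathscr L=\bigoplus_{p\ge2}\mathscr L^p$: $\mathscr L^p$ is the trivial bundle with fibre $L^p$, the curvature $f$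 is the section $x\mapsto x\circ x$ of $\mathscr L^2$, the twisted differential over $\mu\in L^1$ is $d^\mu=[\mu,\cdot\,]:\mathscr L^i\to\mathscr L^{i+1}$, and the bracket is the Gerstenhaber bracket in each fibre. It descends to $M=[L^1/G]$. The underlying classical stack of $X$ is the zero locus of $f$, i.e. the quotient by $G$ of the scheme of associative graded products on $V$. The tangent complex at a point $\mu$ with $f(\mu)=0$ is the complex $L^0\to L^1\to L^2\to L^3\to\cdots$ (with $L^p$ in degree $p$), in which the first map is the infinitesimal action of $G$ at $\mu$ (up to sign), the second is the derivative of $f$ at $\mu$, and the others are the twisted differentials. $H\!H^{*}_{\mathrm{gr}}(V,\mu)$ is the cohomology of the complex with $\mathrm{Hom}_{\mathrm{gr}}(V^{\otimes p},V)$ in degree $p\ge1$, with the Hochschild differential, which on $\alpha:V^{\otimes(p+1)}\to V$ is $(d\alpha)(a_0,\ldots,a_{p+1})=\alpha(a_0,\ldots,a_p)a_{p+1}+(-1)^pa_0\alpha(a_1,\ldots,a_{p+1})-(-1)^p\sum_{i=0}^p(-1)^i\alpha(\ldots,a_ia_{i+1},\ldots)$, writing $\mu$ as concatenation. *)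

(* Defs.v *)
From HB Require Import structures.
From mathcomp Require Import all_boot all_algebra.
From mathcomp Require Import boolp functions.

Set Implicit Arguments.
Unset Strict Implicit.
Unset Printing Implicit Defensive.

Import GRing.Theory.
Local Open Scope ring_scope.

(* The identity [d \o d = 0] is kept apart, as [is_complex]. *)
Record cochainSeq (R : pzRingType) := CochainSeq {
  cobj : nat -> lmodType R;
  cdiff : forall i, {linear cobj i -> cobj i.+1} }.

Arguments cdiff {R} c i.

Definition is_complex (R : pzRingType) (C : cochainSeq R) :=
  forall i (x : cobj C i), cdiff C i.+1 (cdiff C i x) = 0.

Section Cohomology.
Variables (R : pzRingType) (C : cochainSeq R) (i : nat).

Definition cocycle_pred : {pred cobj C i} := fun x => cdiff C i x == 0.

Fact cocycle_submod : submod_closed cocycle_pred.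
Proof.
split=> [|a x y /eqP dx /eqP dy]; first by rewrite unfold_in /= linear0.
by rewrite unfold_in /= linearP dx dy scaler0 addr0.
Qed.

HB.instance Definition _ :=
  GRing.isSubmodClosed.Build _ _ cocycle_pred cocycle_submod.

Record cocycle := Cocycle { cocycle_val : cobj C i; _ : cocycle_val \in cocycle_pred }.

HB.instance Definition _ := [isSub for cocycle_val].
HB.instance Definition _ := [Choice of cocycle by <:].
HB.instance Definition _ := [SubChoice_isSubLmodule of cocycle by <:].

End Cohomology.

(* Coboundaries in degree 0 vanish: the sequence is extended by 0 to the left. *)
Definition is_coboundary (R : pzRingType) (C : cochainSeq R) (i : nat) :
    cobj C i -> Prop :=
  match i with
  | 0 => fun x => x = 0
  | j.+1 => fun x => exists y : cobj C j, x = cdiff C j y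
  end.

Fact is_coboundary0 (R : pzRingType) (C : cochainSeq R) i :
  is_coboundary (0 : cobj C i).
Proof. by case: i => [|j] //; exists 0; rewrite linear0. Qed.

Fact is_coboundaryP (R : pzRingType) (C : cochainSeq R) i a (x y : cobj C i) :
  is_coboundary x -> is_coboundary y -> is_coboundary (a *: x + y).
Proof.
case: i x y => [|j] x y /=; first by move=> -> ->; rewrite scaler0 addr0.
by move=> [x' ->] [y' ->]; exists (a *: x' + y'); rewrite linearP.
Qed.

Section CohomologyQuotient.
Variables (R : pzRingType) (C : cochainSeq R) (i : nat).
Local Open Scope quotient_scope.

Definition coboundary_pred : {pred cocycle C i} :=
  fun z => `[< is_coboundary (cocycle_val z) >].

Fact coboundary_submod : submod_closed coboundary_pred.
Proof.
split=> [|a x y]; rewrite !unfold_in; first exact/asboolP/is_coboundary0.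
by move=> /asboolP bx /asboolP bY; apply/asboolP/is_coboundaryP.
Qed.

HB.instance Definition _ :=
  GRing.isSubmodClosed.Build _ _ coboundary_pred coboundary_submod.

Definition cohomology : Type := Quotient.quot coboundary_pred.

HB.instance Definition _ := GRing.Zmodule.on cohomology.

Definition cclass (z : cocycle C i) : cohomology :=
  \pi_(Quotient.quot coboundary_pred) z.

Definition cohomology_scale (a : R) (h : cohomology) : cohomology :=
  cclass (a *: repr (h : Quotient.quot coboundary_pred)).

Fact cclass_eq (x y : cocycle C i) :
  (cclass x == cclass y) = (x - y \in coboundary_pred).
Proof. by rewrite Quotient.idealrBE. Qed.

Fact cclassK (h : cohomology) :
  cclass (repr (h : Quotient.quot coboundary_pred)) = h.
Proof. exact: reprK. Qed.

Fact cclassD x y : cclass (x + y) = cclass x + cclass y.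
Proof. by rewrite /cclass; exact: (Quotient.pi_add coboundary_pred). Qed.

Fact cohomology_scaleE a x : cohomology_scale a (cclass x) = cclass (a *: x).
Proof.
apply/eqP; rewrite cclass_eq -scalerBr rpredZ //.
by rewrite -cclass_eq cclassK.
Qed.

Fact cohomology_scaleA a b h :
  cohomology_scale a (cohomology_scale b h) = cohomology_scale (a * b) h.
Proof. by rewrite -[h]cclassK !cohomology_scaleE scalerA. Qed.

Fact cohomology_scale1 : left_id 1 cohomology_scale.
Proof. by move=> h; rewrite -[h]cclassK !cohomology_scaleE scale1r. Qed.

Fact cohomology_scaleDr : right_distributive cohomology_scale +%R.
Proof.
move=> a g h; rewrite -[h]cclassK -[g]cclassK -cclassD.
by rewrite !cohomology_scaleE -cclassD scalerDr.
Qed.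

Fact cohomology_scaleDl h :
  {morph cohomology_scale^~ h : a b / a + b}.
Proof.
by move=> a b; rewrite -[h]cclassK !cohomology_scaleE -cclassD scalerDl.
Qed.

HB.instance Definition _ := GRing.Zmodule_isLmodule.Build R cohomology
  cohomology_scaleA cohomology_scale1 cohomology_scaleDr cohomology_scaleDl.

End CohomologyQuotient.

(* An internal direct sum decomposition [V = \bigoplus_(n > 0) V_n], given by
   the projections [gproj n] of [V] onto [V_n]. *)
Record posGrading (R : comNzRingType) (V : lmodType R) := PosGrading {
  gproj : nat -> {linear V -> V};
  gproj_gproj : forall m n v,
    gproj m (gproj n v) = if m == n then gproj n v else 0;
  gproj_sum : forall v, exists N, v = \sum_(n < N) gproj n v;
  gproj0 : forall v, gproj 0%N v = 0 }.

Section Cochains.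
Variables (R : comNzRingType) (V : lmodType R) (gr : posGrading V).
Implicit Types (n p q : nat).

(* [v \in V_n] *)
Definition homog n (v : V) : Prop := gproj gr n v = v.

Definition locally_finite : Prop := forall n, exists (d : nat) (e : 'I_d -> V),
  forall v, homog n v -> exists c : 'I_d -> R, v = \sum_(i < d) c i *: e i.

Definition upd n (a : 'I_n -> V) (i : 'I_n) (x : V) : 'I_n -> V :=
  fun j => if j == i then x else a j.

Definition multilinear n (al : ('I_n -> V) -> V) : Prop :=
  forall a i c x y,
    al (upd a i (c *: x + y)) = c *: al (upd a i x) + al (upd a i y).

Definition degree_preserving n (al : ('I_n -> V) -> V) : Prop :=
  forall (a : 'I_n -> V) (d : 'I_n -> nat),
    (forall i, homog (d i) (a i)) -> homog (\sum_i d i)%N (al a).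

Definition cochain_pred p : {pred ('I_p.+1 -> V) -> V} :=
  fun al => `[< multilinear al /\ degree_preserving al >].

Fact cochain_submod p : submod_closed (@cochain_pred p).
Proof.
split=> [|c al be]; rewrite !unfold_in.
  by apply/asboolP; split=> [a i c x y|a d _] /=;
    rewrite ?scaler0 ?addr0 // /homog linear0.
move=> /asboolP[alM alD] /asboolP[beM beD]; apply/asboolP; split=> /=.
  move=> a i k x y; change ((c *: al (upd a i (k *: x + y)) + be (upd a i (k *: x + y))) =
   k *: (c *: al (upd a i x) + be (upd a i x)) + (c *: al (upd a i y) + be (upd a i y))).
  rewrite alM beM !scalerDr !scalerA mulrC -!addrA; congr (_ + _).
  by rewrite addrCA.
move=> a d ad; rewrite /homog -[(c *: al + be) a]/(c *: al a + be a) linearP.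
by rewrite (alD a d ad) (beD a d ad).
Qed.

HB.instance Definition _ p :=
  GRing.isSubmodClosed.Build _ _ (@cochain_pred p) (@cochain_submod p).

(* [cochain p] is L^p = Hom_gr(V^{\otimes(p+1)}, V). *)
Record cochain p := Cochain {
  cochain_fun :> ('I_p.+1 -> V) -> V; _ : cochain_fun \in @cochain_pred p }.

HB.instance Definition _ p := [isSub for @cochain_fun p].
HB.instance Definition _ p := [Choice of cochain p by <:].
HB.instance Definition _ p := [SubChoice_isSubLmodule of cochain p by <:].

Fact cochainP p (al be : cochain p) : (forall a, al a = be a) -> al = be.
Proof. by move=> E; apply/val_inj/funext. Qed.

Fact cochain_multilinear p (al : cochain p) : multilinear al.
Proof. by case: al => al /= /asboolP[]. Qed.

Fact cochain_degree p (al : cochain p) : degree_preserving al.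
Proof. by case: al => al /= /asboolP[]. Qed.

Fact cochain_addE p (al be : cochain p) a : (al + be) a = al a + be a.
Proof. by []. Qed.

Fact cochain_scaleE p c (al : cochain p) a : (c *: al) a = c *: al a.
Proof. by []. Qed.

Fact cochain_oppE p (al : cochain p) a : (- al) a = - al a.
Proof. by []. Qed.

Fact cochain_zeroE p a : (0 : cochain p) a = 0.
Proof. by []. Qed.

Fact cochain_sumE p I (r : seq I) (F : I -> cochain p) a :
  (\sum_(i <- r) F i) a = \sum_(i <- r) F i a.
Proof. by elim/big_rec2: _ => // i y1 y2 _ <-. Qed.

(* The arguments (a_0, ..., nu(a_i, ..., a_{i+q}), ..., a_n), for n = p + q.
   The arity [n] is kept separate from [p + q] so that [nu \circ mu] can be
   formed in L^{p+q} without a transport along [addnC]. *)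
Definition insert n p q (i : nat) (nu : ('I_q.+1 -> V) -> V)
    (a : 'I_n.+1 -> V) : 'I_p.+1 -> V :=
  fun j => if (j < i)%N then a (inord j)
           else if j == i :> nat then nu (fun k => a (inord (i + k)))
           else a (inord (j + q)).

Definition partial_comp_fun n p q (i : nat) (mu : ('I_p.+1 -> V) -> V)
    (nu : ('I_q.+1 -> V) -> V) : ('I_n.+1 -> V) -> V :=
  fun a => mu (insert i nu a).

Fact partial_comp_subproof n p q (npq : n = (p + q)%N) (i : 'I_p.+1)
    (mu : cochain p) (nu : cochain q) :
  partial_comp_fun i mu nu \in @cochain_pred n.
Proof.
have muM := cochain_multilinear mu; have nuM := cochain_multilinear nu.
apply/asboolP; split.
- move=> a k; have kn := ltn_ord k.
  have ip : (i <= p)%N by rewrite -ltnS.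
  have inE m : (m < n.+1)%N -> (inord m == k :> 'I_n.+1) = (m == k :> nat).
    by move=> mn; rewrite -val_eqE /= inordK.
  case: (ltnP k i) => [ki|ik].
    have E x : insert i nu (upd a k x) =
       upd (insert i nu a) (inord k : 'I_p.+1) x.
      apply/funext=> j; rewrite /insert /upd -(val_eqE j) /= inordK; last first.
        exact: leq_trans ki (leqW ip).
      case: (ltnP j i) => ji; first by rewrite inE // npq ltnS (leq_trans (ltnW ji)) // (leq_trans ip) // leq_addr.
      rewrite [in RHS]gtn_eqF ?(leq_trans ki) //.
      case: eqP => ji'.
        congr (nu _); apply/funext=> l; rewrite inE; last first.
          by rewrite npq ltnS leq_add // -ltnS.
        by rewrite gtn_eqF // (leq_trans ki) // leq_addr.
      rewrite inE; last by rewrite npq ltnS leq_add2r -ltnS.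
      by rewrite gtn_eqF // (leq_trans ki) // (leq_trans ji) // leq_addr.
    by move=> c x y; rewrite /partial_comp_fun !E muM.
  case: (leqP k (i + q)) => [kiq|iqk].
    have kiq' : (k - i < q.+1)%N by rewrite ltnS leq_subLR.
    have E x : insert i nu (upd a k x) =
       upd (insert i nu a) i
         (nu (upd (fun l : 'I_q.+1 => a (inord (i + l))) (Ordinal kiq') x)).
      apply/funext=> j; rewrite /insert /upd -(val_eqE j) /=.
      case: (ltngtP j i) => ji.
      - rewrite inE ?ltn_eqF //; first by rewrite (leq_trans ji).
        by rewrite npq ltnS (leq_trans (ltnW ji)) // (leq_trans ip) // leq_addr.
      - rewrite inE; last by rewrite npq ltnS leq_add2r -ltnS.
        by rewrite gtn_eqF // (leq_ltn_trans kiq) // ltn_add2r.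
      - congr (nu _); apply/funext=> l; rewrite inE; last first.
          by rewrite npq ltnS leq_add // -ltnS.
        by rewrite -val_eqE /= -[in LHS](subnKC ik) eqn_add2l.
    by move=> c x y; rewrite /partial_comp_fun !E nuM muM.
  have kq : (k - q < p.+1)%N by rewrite ltnS leq_subLR addnC -npq -ltnS.
  have qk : (q <= k)%N by rewrite (leq_trans _ (ltnW iqk)) // leq_addl.
  have ikq : (i < k - q)%N by rewrite ltn_subRL addnC.
  have E x : insert i nu (upd a k x) = upd (insert i nu a) (Ordinal kq) x.
    apply/funext=> j; rewrite /insert /upd -(val_eqE j) /=.
    case: (ltngtP j i) => ji.
    - rewrite inE; last by rewrite npq ltnS (leq_trans (ltnW ji)) // (leq_trans ip) // leq_addr.
      rewrite !ltn_eqF //; first exact: ltn_trans ikq.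
      by rewrite (ltn_trans ji) // (leq_ltn_trans _ iqk) // leq_addr.
    - rewrite inE; last by rewrite npq ltnS leq_add2r -ltnS.
      by rewrite -[in LHS](subnK qk) eqn_add2r.
    - rewrite ji ltn_eqF //; congr (nu _); apply/funext=> l; rewrite inE; last first.
        by rewrite npq ltnS leq_add // -ltnS.
      rewrite ltn_eqF // (leq_ltn_trans _ iqk) // leq_add2l -ltnS //.
  by move=> c x y; rewrite /partial_comp_fun !E muM.
- move=> a d ad; rewrite /partial_comp_fun.
  have ip : (i <= p)%N by rewrite -ltnS.
  pose e (j : 'I_p.+1) : nat := if (j < i)%N then d (inord j)
           else if j == i :> nat then (\sum_(k < q.+1) d (inord (i + k)))%N
           else d (inord (j + q)).
  have -> : (\sum_j d j)%N = (\sum_j e j)%N.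
    pose D (m : nat) := d (inord m).
    have -> : (\sum_j d j)%N = (\sum_(0 <= m < n.+1) D m)%N.
      by rewrite big_mkord; apply: eq_bigr => j _; rewrite /D inord_val.
    pose E (m : nat) := if (m < i)%N then D m
           else if m == i :> nat then (\sum_(k < q.+1) D (i + k))%N
           else D (m + q)%N.
    have -> : (\sum_j e j)%N = (\sum_(0 <= m < p.+1) E m)%N by rewrite big_mkord.
    rewrite (@big_cat_nat _ _ _ i) //=; last by rewrite npq (leq_trans ip) // leqW // leq_addr.
    rewrite [RHS](@big_cat_nat _ _ _ i) //=; last exact: leqW.
    congr (_ + _)%N.
      by rewrite !big_nat; apply: eq_bigr => m /andP[_ mi]; rewrite /E mi.
    rewrite [RHS]big_ltn // {1}/E ltnn eqxx.
    rewrite (@big_cat_nat _ _ _ (i + q.+1)) ?leq_addr //=; last first.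
      by rewrite npq addnS ltnS leq_add2r.
    congr (_ + _)%N.
      rewrite -{1}[nat_of_ord i]add0n [in LHS]big_addn addKn big_mkord.
      by apply: eq_bigr => k _; rewrite addnC.
    rewrite addnS -addSn big_addn npq -addSn addnK !big_nat.
    apply: eq_bigr => m /andP[im _]; rewrite /E.
    by rewrite ltnNge (ltnW im) /= gtn_eqF.
  rewrite /homog; apply: cochain_degree => j; rewrite /insert /e.
  case: ifP => _; first exact: ad.
  case: ifP => _; last exact: ad.
  by apply: cochain_degree.
Qed.

Definition partial_comp n p q (npq : n = (p + q)%N) (i : 'I_p.+1)
    (mu : cochain p) (nu : cochain q) : cochain n :=
  Cochain (partial_comp_subproof npq i mu nu).

Definition circ n p q (npq : n = (p + q)%N) (mu : cochain p) (nu : cochain q) :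
    cochain n :=
  \sum_(i < p.+1) (-1) ^+ (i * q) *: partial_comp npq i mu nu.

Definition bracket p q (mu : cochain p) (nu : cochain q) : cochain (p + q) :=
  circ erefl mu nu - (-1) ^+ (p * q) *: circ (addnC p q) nu mu.

Fact circE n p q (npq : n = (p + q)%N) (mu : cochain p) (nu : cochain q) a :
  circ npq mu nu a = \sum_(i < p.+1) (-1) ^+ (i * q) *: mu (insert i nu a).
Proof. by rewrite /circ cochain_sumE. Qed.

Fact insertP n p q (i : 'I_p.+1) (nu : ('I_q.+1 -> V) -> V) (a : 'I_n.+1 -> V) :
  insert i nu a =
  upd (insert i (fun _ : 'I_q.+1 -> V => 0) a) i (nu (fun k => a (inord (i + k)))) :> ('I_p.+1 -> V).
Proof.
apply/funext=> j; rewrite /upd /insert -val_eqE /=.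
by case: ltngtP.
Qed.

Fact circ_is_linearl n p q (npq : n = (p + q)%N) (nu : cochain q) :
  linear (fun mu : cochain p => circ npq mu nu).
Proof.
move=> c x y; apply: cochainP => a.
rewrite cochain_addE cochain_scaleE !circE scaler_sumr -big_split.
apply: eq_bigr => i _; rewrite cochain_addE cochain_scaleE scalerDr.
by rewrite !scalerA mulrC.
Qed.

Fact circ_is_linearr n p q (npq : n = (p + q)%N) (mu : cochain p) :
  linear (fun nu : cochain q => circ npq mu nu).
Proof.
move=> c x y; apply: cochainP => a.
rewrite cochain_addE cochain_scaleE !circE scaler_sumr -big_split.
apply: eq_bigr => i _; rewrite !(insertP i (cochain_fun _)).
rewrite cochain_addE cochain_scaleE cochain_multilinear scalerDr.
by rewrite !scalerA mulrC.
Qed.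

Definition curvature (x : cochain 1) : cochain 2 := circ (erefl (1 + 1)%N) x x.

Definition twisted_diff (mu : cochain 1) p (al : cochain p) : cochain p.+1 :=
  bracket mu al.

Fact twisted_diff_is_linear mu p : linear (@twisted_diff mu p).
Proof.
move=> c x y; rewrite /twisted_diff /bracket circ_is_linearr circ_is_linearl.
rewrite scalerDr opprD scalerBr !scalerA mulrC -!addrA; congr (_ + _).
by rewrite addrCA.
Qed.

HB.instance Definition _ mu p :=
  GRing.isLinear.Build R _ _ _ (@twisted_diff mu p) (@twisted_diff_is_linear mu p).

(* (L, d^mu) *)
Definition twisted_complex (mu : cochain 1) : cochainSeq R :=
  @CochainSeq R (fun p => cochain p) (fun p => @twisted_diff mu p).

Definition product (mu : cochain 1) (x y : V) : V :=
  mu (fun j : 'I_2 => if j == ord0 then x else y).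

Section Hochschild.
Variable mu : cochain 1.
Local Notation "x ** y" := (product mu x y) (at level 40).

Definition hochschild_fun p (al : ('I_p.+1 -> V) -> V) : ('I_p.+2 -> V) -> V :=
  fun a =>
    al (fun j => a (inord j)) ** a ord_max
    + (-1) ^+ p *: (a ord0 ** al (fun j => a (inord j.+1)))
    - (-1) ^+ p *: (\sum_(i < p.+1) (-1) ^+ i *:
        al (fun j => if (j < i)%N then a (inord j)
                     else if j == i then a (inord i) ** a (inord i.+1)
                     else a (inord j.+1))).

Fact hochschild_funE p (al : cochain p) :
  hochschild_fun al = twisted_diff mu al.
Proof.
apply/funext=> a; rewrite /twisted_diff /bracket !cochain_addE cochain_oppE.
rewrite cochain_scaleE !circE big_ord_recl big_ord1 /= mul0n !mul1n expr0 scale1r.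
congr (_ + _ *: _ - _ *: _).
- congr (cochain_fun mu _); apply/funext=> j; rewrite /insert -val_eqE /=.
  case: j => -[|[|]]//= ?.
  by congr a; apply: val_inj; rewrite /= inordK.
- congr (cochain_fun mu _); apply/funext=> j; rewrite /insert -val_eqE /=.
  case: j => -[|[|]]//= ?.
  by congr a; apply: val_inj; rewrite /= inordK.
- apply: eq_bigr => i _; rewrite muln1; congr (_ *: cochain_fun al _).
  apply/funext=> j; rewrite /insert -val_eqE addn1 /=.
  case: ifP => // _; case: ifP => // _; congr (cochain_fun mu _).
  apply/funext=> k; rewrite -val_eqE /=.
  by case: k => -[|[|]]//= ?; rewrite ?addn0 ?addn1.
Qed.

Fact hochschild_subproof p (al : cochain p) :
  hochschild_fun al \in @cochain_pred p.+1.
Proof. by rewrite hochschild_funE; case: (twisted_diff mu al). Qed.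

Definition hochschild_diff p (al : cochain p) : cochain p.+1 :=
  Cochain (hochschild_subproof al).

Fact hochschild_diff_is_linear p : linear (@hochschild_diff p).
Proof.
have E al : @hochschild_diff p al = twisted_diff mu al.
  by apply/val_inj/hochschild_funE.
by move=> c x y; rewrite !E linearP.
Qed.

HB.instance Definition _ p :=
  GRing.isLinear.Build R _ _ _ (@hochschild_diff p) (@hochschild_diff_is_linear p).

(* Hom_gr(V^{\otimes i}, V) sits in degree i >= 1, and 0 in degree 0. *)
Definition hochschild_obj (i : nat) : lmodType R :=
  if i is p.+1 then cochain p else 'rV[R]_0.

Definition hochschild_complex : cochainSeq R :=
  @CochainSeq R hochschild_obj (fun i =>
    match i return {linear hochschild_obj i -> hochschild_obj i.+1} with
    | 0 => \0
    | p.+1 => @hochschild_diff p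
    end).

Definition HHgr (i : nat) : lmodType R := cohomology hochschild_complex i.

End Hochschild.

(* An element of \prod_n GL(V_n) is a degree preserving automorphism of V. *)

Record gauge := Gauge {
  gauge_fun :> {linear V -> V};
  gauge_inv : {linear V -> V};
  gauge_funK : cancel gauge_fun gauge_inv;
  gauge_invK : cancel gauge_inv gauge_fun;
  gauge_homog : forall n v, homog n v -> homog n (gauge_fun v);
  gauge_inv_homog : forall n v, homog n v -> homog n (gauge_inv v) }.

Definition gauge_act_fun p (g : gauge) (al : ('I_p.+1 -> V) -> V) :
    ('I_p.+1 -> V) -> V :=
  fun a => g (al (fun j => gauge_inv g (a j))).

Fact gauge_act_subproof p (g : gauge) (al : cochain p) :
  gauge_act_fun g al \in @cochain_pred p.
Proof.
apply/asboolP; split=> [a i c x y|a d ad]; rewrite /gauge_act_fun.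
  have E z : (fun j => gauge_inv g (upd a i z j)) =
             upd (fun j => gauge_inv g (a j)) i (gauge_inv g z).
    by apply/funext=> j; rewrite /upd; case: ifP.
  by rewrite !E linearP cochain_multilinear linearP.
apply: gauge_homog; apply: cochain_degree => j; exact: gauge_inv_homog.
Qed.

Definition gauge_act p (g : gauge) (al : cochain p) : cochain p :=
  Cochain (gauge_act_subproof g al).

End Cochains.

(* Derivatives on L^1 and on the gauge group, which may be infinite dimensional,
   are taken as coefficients of eps on points over the dual numbers R[eps]. *)

Definition dual (R : Type) : Type := (R * R)%type.

Section DualNumbers.
Variable R : comNzRingType.

HB.instance Definition _ := GRing.Zmodule.copy (dual R) (R * R)%type.

Definition dual_one : dual R := (1, 0).
Definition dual_mul (a b : dual R) : dual R :=
  (a.1 * b.1, a.1 * b.2 + a.2 * b.1).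

Fact dual_mulA : associative dual_mul.
Proof.
move=> a b c; congr (_, _) => /=; first exact: mulrA.
by rewrite mulrDr mulrDl !mulrA addrA.
Qed.

Fact dual_mulC : commutative dual_mul.
Proof.
move=> [a a'] [b b']; congr (_, _) => /=; first exact: mulrC.
by rewrite addrC [a' * b]mulrC [a * b']mulrC.
Qed.

Fact dual_mul1 : left_id dual_one dual_mul.
Proof. by case=> a b; rewrite /dual_mul /= !mul1r mul0r addr0. Qed.

Fact dual_mulDl : left_distributive dual_mul +%R.
Proof.
by move=> a b c; congr (_, _) => /=; rewrite !mulrDl // addrACA.
Qed.

Fact dual_one_neq0 : dual_one != 0.
Proof. by apply/eqP => -[/eqP]; rewrite oner_eq0. Qed.

HB.instance Definition _ := GRing.Zmodule_isComNzRing.Build (dual R)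
  dual_mulA dual_mulC dual_mul1 dual_mulDl dual_one_neq0.

Definition eps : dual R := (0, 1).

End DualNumbers.

(* [dualExt V] is V[eps] = V \otimes_R R[eps], with [(x, y)] for x + eps y. *)
Definition dualExt (R : comNzRingType) (V : lmodType R) : Type := (V * V)%type.

Section DualExtension.
Variables (R : comNzRingType) (V : lmodType R).

HB.instance Definition _ := GRing.Zmodule.copy (dualExt V) (V * V)%type.

Definition dual_scale (c : dual R) (v : dualExt V) : dualExt V :=
  (c.1 *: v.1, c.1 *: v.2 + c.2 *: v.1).

Fact dual_scaleA a b v : dual_scale a (dual_scale b v) = dual_scale (a * b) v.
Proof.
congr (_, _) => /=; first exact: scalerA.
by rewrite scalerDr scalerDl !scalerA addrA.
Qed.

Fact dual_scale1 : left_id 1 dual_scale.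
Proof. by case=> x y; rewrite /dual_scale /= !scale1r scale0r addr0. Qed.

Fact dual_scaleDr : right_distributive dual_scale +%R.
Proof. by move=> c u v; congr (_, _) => /=; rewrite !scalerDr // addrACA. Qed.

Fact dual_scaleDl v : {morph dual_scale^~ v : a b / a + b}.
Proof. by move=> a b; congr (_, _) => /=; rewrite !scalerDl // addrACA. Qed.

HB.instance Definition _ := GRing.Zmodule_isLmodule.Build (dual R) (dualExt V)
  dual_scaleA dual_scale1 dual_scaleDr dual_scaleDl.

Variable gr : posGrading V.

Definition dual_gproj n (v : dualExt V) : dualExt V :=
  (gproj gr n v.1, gproj gr n v.2).

Fact dual_gproj_is_linear n : linear (dual_gproj n).
Proof.
move=> c u v; congr (_, _) => /=; first by rewrite linearP.
by rewrite linearD /= linearP linearZ.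
Qed.

HB.instance Definition _ n := GRing.isLinear.Build (dual R) _ _ _
  (dual_gproj n) (dual_gproj_is_linear n).

Fact dual_gproj_gproj m n v :
  dual_gproj m (dual_gproj n v) = if m == n then dual_gproj n v else 0.
Proof. by rewrite /dual_gproj /= !gproj_gproj; case: eqP. Qed.

Fact gproj_sum_le (v : V) N M : v = \sum_(n < N) gproj gr n v ->
  (N <= M)%N -> v = \sum_(n < M) gproj gr n v.
Proof.
move=> vE NM; rewrite -(subnKC NM) big_split_ord /= -vE big1 ?addr0 // => i _.
rewrite vE linear_sum big1 // => j _; rewrite gproj_gproj.
by rewrite gtn_eqF // (leq_trans (ltn_ord j)) // leq_addr.
Qed.

Fact dual_gproj_sum v : exists N, v = \sum_(n < N) dual_gproj n v.
Proof.
have [N1 v1] := gproj_sum gr v.1; have [N2 v2] := gproj_sum gr v.2.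
exists (maxn N1 N2); rewrite [LHS]surjective_pairing.
rewrite {1}(gproj_sum_le v1 (leq_maxl N1 N2)).
rewrite {1}(gproj_sum_le v2 (leq_maxr N1 N2)).
by elim/big_rec3: _ => // i y1 y2 y3 _ <-.
Qed.

Fact dual_gproj0 v : dual_gproj 0 v = 0.
Proof. by rewrite /dual_gproj !gproj0. Qed.

Definition dual_grading : posGrading (dualExt V) :=
  @PosGrading (dual R) (dualExt V) (fun n => dual_gproj n)
    dual_gproj_gproj dual_gproj_sum dual_gproj0.

Fact dual_homog n (v : dualExt V) :
  homog dual_grading n v <-> homog gr n v.1 /\ homog gr n v.2.
Proof.
case: v => x y; split=> [[hx hy]|[/= hx hy]]; first by split.
by congr (_, _).
Qed.

(* The R[eps]-multilinear extension of a cochain to V[eps]. *)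
Definition dual_ext_fun p (al : ('I_p.+1 -> V) -> V) :
    ('I_p.+1 -> dualExt V) -> dualExt V :=
  fun a => let x j := (a j).1 in let y j := (a j).2 in
    (al x, \sum_j al (upd x j (y j))).

Fact dual_ext_subproof p (al : cochain gr p) :
  dual_ext_fun al \in @cochain_pred _ _ dual_grading p.
Proof.
have alM := cochain_multilinear al.
apply/asboolP; split=> [a i c u v|a d ad].
  pose x j := (a j).1; pose y j := (a j).2.
  have E w : dual_ext_fun al (upd a i w) = (al (upd x i w.1),
      al (upd x i w.2) + \sum_(j | j != i) al (upd (upd x j (y j)) i w.1)).
    have E1 : (fun j => (upd a i w j).1) = upd x i w.1.
      by apply/funext=> j; rewrite /upd; case: ifP.
    congr (_, _); rewrite E1 // (bigD1 i) //=; congr (_ + _).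
      congr (cochain_fun al _); apply/funext=> j; rewrite /upd eqxx.
      by case: ifP => // ->.
    apply: eq_bigr => j /negPf ji; congr (cochain_fun al _).
    apply/funext=> k; rewrite /upd ji.
    by case: (eqVneq k j) => [->|//]; rewrite ji.
  rewrite !E; congr (_, _) => /=; first exact: alM.
  rewrite -[_ + v.2]addrA !alM scalerDr.
  rewrite (_ : \sum_(j | j != i) _ =
     c.1 *: (\sum_(j | j != i) al (upd (upd x j (y j)) i u.1)) +
     \sum_(j | j != i) al (upd (upd x j (y j)) i v.1)); last first.
    by rewrite scaler_sumr -big_split; apply: eq_bigr => j _; apply: alM.
  by rewrite addrACA !addrA.
have ad1 j : homog gr (d j) (a j).1 by case/dual_homog: (ad j).
have ad2 j : homog gr (d j) (a j).2 by case/dual_homog: (ad j).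
apply/dual_homog; split; first exact: cochain_degree.
rewrite /homog linear_sum; apply: eq_bigr => j _; apply: cochain_degree => k.
by rewrite /upd; case: eqP => [->|_].
Qed.

Definition dual_ext p (al : cochain gr p) : cochain dual_grading p :=
  Cochain (dual_ext_subproof al).

(* The coefficient of [eps], in L^p, of a cochain over R[eps]. *)
Definition eps_coef_fun p (al : ('I_p.+1 -> dualExt V) -> dualExt V) :
    ('I_p.+1 -> V) -> V :=
  fun a => (al (fun j => (a j, 0))).2.

Fact eps_coef_subproof p (al : cochain dual_grading p) :
  eps_coef_fun al \in @cochain_pred _ _ gr p.
Proof.
apply/asboolP; split=> [a i c x y|a d ad]; rewrite /eps_coef_fun.
  have E z : (fun j => (upd a i z j, 0)) =
      upd (fun j => (a j, 0) : dualExt V) i (z, 0).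
    by apply/funext=> j; rewrite /upd; case: ifP.
  have Z : ((c *: x + y, 0) : dualExt V) =
      ((c, 0) : dual R) *: ((x, 0) : dualExt V) + ((y, 0) : dualExt V).
    by congr (_, _); rewrite /= scaler0 scale0r !addr0.
  by rewrite !E Z cochain_multilinear /= scale0r addr0.
have: homog dual_grading (\sum_i d i)%N (al (fun j => (a j, 0))).
  apply: cochain_degree => j; apply/dual_homog; split; first exact: ad.
  by rewrite /homog linear0.
by case/dual_homog.
Qed.

Definition eps_coef p (al : cochain dual_grading p) : cochain gr p :=
  Cochain (eps_coef_subproof al).

(* 1 + eps xi *)
Definition infinitesimal_fun (xi : cochain gr 0) (v : dualExt V) : dualExt V :=
  (v.1, v.2 + xi (fun=> v.1)).

Fact cochain0_linear (xi : cochain gr 0) c x y :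
  xi (fun=> c *: x + y) = c *: xi (fun=> x) + xi (fun=> y).
Proof.
have E z : (fun=> z) = upd (fun=> 0) ord0 z :> ('I_1 -> V).
  by apply/funext=> j; rewrite /upd ord1.
by rewrite (E (_ + _)) cochain_multilinear -!E.
Qed.

Fact infinitesimal_is_linear xi : linear (infinitesimal_fun xi).
Proof.
move=> c u v; congr (_, _) => //=; rewrite cochain0_linear scalerDr.
by rewrite addrACA; congr (_ + _); apply: addrAC.
Qed.

HB.instance Definition _ xi := GRing.isLinear.Build (dual R) _ _ _
  (infinitesimal_fun xi) (infinitesimal_is_linear xi).

Fact infinitesimalK xi :
  cancel (infinitesimal_fun xi) (infinitesimal_fun (- xi)).
Proof.
by case=> x y; rewrite /infinitesimal_fun cochain_oppE addrK.
Qed.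

Fact infinitesimalVK xi :
  cancel (infinitesimal_fun (- xi)) (infinitesimal_fun xi).
Proof.
by case=> x y; rewrite /infinitesimal_fun cochain_oppE addrNK.
Qed.

Fact infinitesimal_homog xi n v :
  homog dual_grading n v -> homog dual_grading n (infinitesimal_fun xi v).
Proof.
move=> /dual_homog[h1 h2]; apply/dual_homog; split=> //=.
rewrite /homog linearD /= h2; congr (_ + _).
have := @cochain_degree _ _ _ _ xi (fun=> v.1) (fun=> n) (fun=> h1).
by rewrite big_ord1.
Qed.

Definition infinitesimal_gauge (xi : cochain gr 0) : gauge dual_grading :=
  @Gauge _ _ dual_grading (infinitesimal_fun xi) (infinitesimal_fun (- xi))
    (infinitesimalK xi) (infinitesimalVK xi)
    (@infinitesimal_homog xi) (@infinitesimal_homog (- xi)).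

Variable mu : cochain gr 1.

(* (1 + eps xi) . mu = mu + eps (infinitesimal_action xi) *)
Definition infinitesimal_action (xi : cochain gr 0) : cochain gr 1 :=
  eps_coef (gauge_act (infinitesimal_gauge xi) (dual_ext mu)).

(* f(mu + eps nu) = f(mu) + eps (curvature_derivative nu) *)
Definition curvature_derivative (nu : cochain gr 1) : cochain gr 2 :=
  eps_coef (curvature (dual_ext mu + eps R *: dual_ext nu)).

(* The sign in degree 0 is the one for which this is d^mu: the infinitesimal
   action of xi at mu is [xi, mu] = - [mu, xi]. *)
Definition tangent_diff p : cochain gr p -> cochain gr p.+1 :=
  match p with
  | 0 => fun xi => - infinitesimal_action xi
  | 1 => fun nu => curvature_derivative nu
  | _ => fun al => twisted_diff mu al
  end.

Fact infinitesimal_actionE xi a : infinitesimal_action xi a =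
  xi (fun=> mu a) - \sum_j mu (upd a j (xi (fun=> a j))).
Proof.
rewrite [LHS]addrC; congr (_ + _); rewrite -sumrN; apply: eq_bigr => j _ /=.
have := cochain_multilinear mu a j (-1) 0 0.
rewrite scaler0 add0r scaleN1r addNr => mu0.
have := cochain_multilinear mu a j (-1) (xi (fun=> a j)) 0.
by rewrite mu0 !scaleN1r !addr0 => <-; rewrite add0r.
Qed.

Fact infinitesimal_action_is_linear : linear infinitesimal_action.
Proof.
move=> c x y; apply: cochainP => a; rewrite cochain_addE cochain_scaleE.
rewrite !infinitesimal_actionE scalerBr addrACA -opprD; congr (_ - _).
rewrite scaler_sumr -big_split; apply: eq_bigr => j _.
exact: cochain_multilinear.
Qed.

Fact curvature_derivativeE nu : curvature_derivative nu =
  circ (erefl (1 + 1)%N) mu nu + circ (erefl (1 + 1)%N) nu mu.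
Proof.
apply: cochainP => a; rewrite cochain_addE !circE -big_split /=.
pose Phi := dual_ext mu + eps R *: dual_ext nu.
pose a' j : dualExt V := (a j, 0).
have PhiE (x : 'I_2 -> dualExt V) : Phi x = (mu (fun j => (x j).1),
    \sum_j mu (upd (fun j => (x j).1) j (x j).2) + nu (fun j => (x j).1)).
  by congr (_, _); rewrite /= ?scale0r ?addr0 ?scale1r ?add0r.
have PhiD : dual_ext mu + eps R *: dual_ext nu = Phi by [].
clearbody Phi.
have mu0 x j : mu (upd x j 0) = 0.
  have := cochain_multilinear mu x j (-1) 0 0.
  by rewrite scaler0 add0r scaleN1r addNr.
have PhiA (x : 'I_2 -> V) : Phi (fun j => (x j, 0)) = (mu x, nu x).
  by rewrite PhiE /= big1 ?add0r // => j _; apply: mu0.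
have T (i : 'I_2) : (Phi (insert i Phi a')).2 =
    mu (insert i nu a) + nu (insert i mu a).
  rewrite PhiE /=; have -> : (fun j : 'I_2 => (insert i Phi a' j).1) = insert i mu a.
    apply/funext=> j; rewrite /insert; case: ifP => // _; case: ifP => // _.
    by rewrite PhiA.
  congr (_ + _); rewrite (bigD1 i) //= big1 ?addr0 => [|j ji].
    rewrite {2}/insert ltnn eqxx PhiA /= [in RHS]insertP.
    congr (cochain_fun mu _); apply/funext=> j; rewrite /upd /insert -val_eqE /=.
    by case: ltngtP.
  rewrite {2}/insert; move: ji; rewrite -val_eqE /= => /negPf->.
  by case: ifP => _; rewrite mu0.
transitivity (\sum_(i < 2) (-1) ^+ (i * 1) *: Phi (insert i Phi a')).2.
  by rewrite -circE -PhiD.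
rewrite !big_ord_recl !big_ord0 /= !mul1n !mul0n !expr0 !expr1 !scale1r !scaleN1r.
have T0 : (Phi (insert 0 Phi a')).2 = mu (insert 0 nu a) + nu (insert 0 mu a).
  exact: (T ord0).
have T1 : (Phi (insert (bump 0 0) Phi a')).2 =
    mu (insert (bump 0 0) nu a) + nu (insert (bump 0 0) mu a).
  exact: (T (lift ord0 ord0)).
by rewrite !addr0 oppr0 !scale0r !addr0 T0 T1 opprD.
Qed.

Fact curvature_derivative_is_linear : linear curvature_derivative.
Proof.
move=> c x y; rewrite !curvature_derivativeE circ_is_linearr circ_is_linearl.
by rewrite scalerDr addrACA.
Qed.

Fact tangent_diff_is_linear p : linear (@tangent_diff p).
Proof.
case: p => [|[|p]] c x y /=; last exact: linearP.
  by rewrite infinitesimal_action_is_linear opprD scalerN.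
exact: curvature_derivative_is_linear.
Qed.

HB.instance Definition _ p :=
  GRing.isLinear.Build R _ _ _ (@tangent_diff p) (@tangent_diff_is_linear p).

Definition tangent_complex : cochainSeq R :=
  @CochainSeq R (fun p => cochain gr p) (fun p => @tangent_diff p).

End DualExtension.

(* Main.v *)
Require Import Defs.
From mathcomp Require Import all_boot all_algebra.
From HB Require Import structures.
From mathcomp Require Import boolp.

Set Implicit Arguments.
Unset Strict Implicit.
Unset Printing Implicit Defensive.

Import GRing.Theory.
Local Open Scope ring_scope.

(** The differential of the tangent complex is computed over the dual numbers in
    degrees 0 and 1: there it is [xi |-> - [xi, mu] = [mu, xi]] and
    [nu |-> mu \o nu + nu \o mu = [mu, nu]], so it is [d^mu] in every degree, and
    this is the Hochschild differential.  Up to the sign [(-1)^p] the latter is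
    an alternating sum of coface maps, whose cosimplicial identities
    follow from the associativity of [mu]; hence its square vanishes.  The two
    complexes then agree up to the shift, and so do their cohomologies. *)

(** * Cancellation in a double alternating sum *)

Section AlternatingSums.
Variables (R : pzRingType) (U : lmodType R).

(** Terms with [i < j] cancel those with [j <= i]: the hypothesis sends the pair [(j, i)] to
    [(i, j.-1)], whose sign is opposite. *)
Lemma alternating_cosimplicial_sum n (G : nat -> nat -> U) :
  (forall i j, (i < j <= n)%N -> G j i = G i j.-1) ->
  \sum_(j < n.+1) (-1) ^+ j *: (\sum_(i < n) (-1) ^+ i *: G j i) = 0.
Proof.
move=> GE.
pose S j := \sum_(i < n | (i < j)%N) (-1) ^+ (i + j) *: G j i.
pose T j := \sum_(i < n | (j <= i)%N) (-1) ^+ (i + j) *: G j i.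
transitivity (\sum_(j < n.+1) S j + \sum_(j < n.+1) T j).
  rewrite -big_split; apply: eq_bigr => j _.
  rewrite scaler_sumr (bigID (fun i : 'I_n => (i < j)%N)) /=; congr (_ + _).
    by apply: eq_bigr => i _; rewrite scalerA -exprD addnC.
  by apply: eq_big => [i|i _]; [rewrite -leqNgt|rewrite scalerA -exprD addnC].
(* The first [S] and the last [T] are empty, so after shifting [S] both sums run over [j < n];
   together they are the entries of a matrix [H] minus those of its transpose. *)
have S0 : S 0%N = 0 by rewrite /S big_pred0.
have Tn : T n = 0 by rewrite /T big_pred0 // => i; rewrite leqNgt ltn_ord.
rewrite big_ord_recl S0 add0r [X in _ + X]big_ord_recr /= Tn addr0 -big_split /=.
pose H (i j : 'I_n) := if (i <= j)%N then (-1) ^+ (i + j) *: G i j else 0.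
transitivity (\sum_(j < n) (\sum_(i < n) H j i - \sum_(i < n) H i j)).
  apply: eq_bigr => j _; rewrite addrC; congr (_ + _).
    by rewrite /T big_mkcond; apply: eq_bigr => i _; rewrite /H addnC.
  rewrite /S big_mkcond -sumrN; apply: eq_bigr => i _; rewrite /H ltnS.
  case: ifP => ij; last by rewrite oppr0.
  by rewrite GE ?ltnS ?ij ?ltn_ord // addnS exprS mulN1r scaleNr.
by rewrite sumrB [X in _ - X]exchange_big subrr.
Qed.

End AlternatingSums.

(** * Bilinearity of the product *)

Section ProductBilinear.
Variables (R : comNzRingType) (V : lmodType R) (gr : posGrading V).
Variable mu : cochain gr 1.

(** Named so that linearity in the left factor can be declared as an instance. *)
Definition productr z x := product mu x z.

Lemma product_linearl z : linear (productr z).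
Proof.
have E x : productr z x = mu (upd (fun=> z) ord0 x) by [].
by move=> c x y; rewrite !E cochain_multilinear.
Qed.

Lemma product_linearr z : linear (product mu z).
Proof.
have E y : product mu z y = mu (upd (fun=> z) ord_max y).
  congr (cochain_fun mu _); apply/funext => -[[|[|k]] kP] //.
by move=> c x y; rewrite !E cochain_multilinear.
Qed.

HB.instance Definition _ z :=
  GRing.isLinear.Build R _ _ _ (productr z) (product_linearl z).
HB.instance Definition _ z :=
  GRing.isLinear.Build R _ _ _ (product mu z) (product_linearr z).

End ProductBilinear.

(** * Hochschild cofaces and their cosimplicial identities *)

Section Cofaces.
Variables (R : comNzRingType) (V : lmodType R) (gr : posGrading V).
Variable mu : cochain gr 1.
Local Notation "x ** y" := (product mu x y) (at level 40).
Implicit Types (b : nat -> V) (F : (nat -> V) -> V).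

Definition merge i b : nat -> V :=
  fun j => if (j < i)%N then b j else if j == i then b i ** b i.+1 else b j.+1.

(* Cochains are evaluated on infinite sequences, of which they read the entries
   of index at most [p]; this avoids all transports between ordinals. *)
Definition eval_seq p (al : cochain gr p) : (nat -> V) -> V :=
  fun b => al (fun j => b j).

(** The cofaces are those with [0 <= i <= p.+2]. The number [p.+1] of arguments is invisible in the
    type of [F], hence the explicit [p]. *)
Definition coface p i F : (nat -> V) -> V := fun b =>
  if i is k.+1 then
    if (k <= p)%N then F (merge k b) else F b ** b p.+1
  else b 0%N ** F (fun j => b j.+1).

Lemma eval_seq_local p (al : cochain gr p) b b' :
  (forall j, (j <= p)%N -> b j = b' j) -> eval_seq al b = eval_seq al b'.
Proof.
by move=> bb'; congr (cochain_fun al _); apply/funext => j; rewrite bb' // -ltnS.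
Qed.

Lemma coface_sum p i n (e : 'I_n -> R) (H : 'I_n -> (nat -> V) -> V) c b :
  coface p i (fun b' => c *: \sum_k e k *: H k b') b =
  c *: \sum_k e k *: coface p i (H k) b.
Proof.
case: i => [|i] /=; last case: ifP => // _.
- by rewrite linearZ linear_sum; congr (_ *: _); apply: eq_bigr => k _; rewrite linearZ.
- rewrite -!/(productr mu _ _) linearZ linear_sum; congr (_ *: _).
  by apply: eq_bigr => k _; rewrite linearZ.
Qed.

Lemma hochschild_diff_coface p (al : cochain gr p) b :
  eval_seq (hochschild_diff mu al) b =
  (-1) ^+ p *: \sum_(i < p.+3) (-1) ^+ i *: coface p i (eval_seq al) b.
Proof.
(* The global sign cancels that of the last coface, whose term is the unsigned one in the Hochschild
   formula. *)
have sgn : (-1) ^+ p * (-1) ^+ p.+2 = 1 :> R.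
  by rewrite -exprD !addnS addnn -signr_odd /= odd_double.
rewrite big_ord_recl big_ord_recr /= /bump leq0n add1n ltnn expr0 scale1r.
rewrite !scalerDr scalerA sgn scale1r.
rewrite [RHS]addrA [RHS]addrC [RHS]addrA /eval_seq /= /hochschild_fun.
have bE (j : 'I_p.+1) : b (inord j : 'I_p.+2) = b j.
  by rewrite inordK // ltnW // ltnS.
have bSE (j : 'I_p.+1) : b (inord j.+1 : 'I_p.+2) = b j.+1.
  by rewrite inordK // ltnS.
congr (_ ** _ + _ *: (_ ** _) + _).
- by congr (cochain_fun al _); apply/funext => j; rewrite bE.
- by congr (cochain_fun al _); apply/funext => j; rewrite bSE.
rewrite -scalerN -sumrN; congr (_ *: _); apply: eq_bigr => i _.
rewrite exprS mulN1r scaleNr -ltnS ltn_ord.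
congr (- (_ *: cochain_fun al _)); apply/funext => j; rewrite /merge -val_eqE /=.
by rewrite !bE !bSE.
Qed.

Lemma merge_lt i b k : (k < i)%N -> merge i b k = b k.
Proof. by rewrite /merge => ->. Qed.

Lemma merge_eq i b : merge i b i = b i ** b i.+1.
Proof. by rewrite /merge ltnn eqxx. Qed.

Lemma merge_gt i b k : (i < k)%N -> merge i b k = b k.+1.
Proof. by rewrite /merge; case: ltngtP. Qed.

(** For [i < j] the merged pairs are disjoint and only indices shift. For [i = j] both sides
    multiply the same three consecutive entries, bracketed differently. *)
Lemma merge_merge (muA : associative (product mu)) i j b :
  (i <= j)%N -> merge i (merge j.+1 b) = merge j (merge i b).
Proof.
move=> ij; apply/funext => k; case: (ltngtP k i) => [ki|ik|->{k}].
- by rewrite !merge_lt ?(leq_trans ki) // leqW.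
- rewrite merge_gt //; case: (ltngtP k j) ik => [kj|jk|->] ik.
  + by rewrite merge_lt ?ltnS // merge_lt // merge_gt.
  + by rewrite !merge_gt // leqW.
  + by rewrite !merge_eq !merge_gt // leqW.
rewrite merge_eq (merge_lt _ (_ : i < j.+1)%N) //; case: (ltngtP i j) ij => // [ij|<-] _.
  by rewrite merge_lt ?ltnS // (merge_lt _ ij) merge_eq.
by rewrite !merge_eq merge_gt ?muA.
Qed.

(** Two merges commute by [merge_merge]; beyond that, associativity enters when two outer
    multiplications act on the same side or on opposite sides. *)
Lemma coface_coface (muA : associative (product mu)) p (al : cochain gr p) i j b :
  (i < j <= p.+3)%N ->
  coface p.+1 j (coface p i (eval_seq al)) b =
  coface p.+1 i (coface p j.-1 (eval_seq al)) b.
Proof.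
case: j => [|j] //; rewrite ltnS => /andP[ij jp] /=.
case: i ij => [|i] ij; first case: j ij jp => [|j] _ jp /=.
- by rewrite muA.
- by rewrite ltnS; case: ifP => // _; rewrite muA.
case: j ij jp => // j; rewrite !ltnS => ij jp.
rewrite /coface (leq_trans ij jp); case: (leqP j p) => jp'.
  by rewrite (leq_trans ij jp') merge_merge.
have jE : j = p.+1 by apply/eqP; rewrite eqn_leq jp.
rewrite {j}jE in ij jp jp' *; case: (leqP i p) => ip; first by rewrite merge_gt.
have -> : i = p.+1 by apply/eqP; rewrite eqn_leq ij.
(* Two right multiplications remain; [al] reads indices up to [p] only, which the merge at [p.+1]
   leaves alone. *)
rewrite -muA merge_eq; congr (_ ** _).
by apply: eval_seq_local => k kp; rewrite merge_lt.
Qed.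

Lemma hochschild_diff_diff (muA : associative (product mu)) p (al : cochain gr p) :
  hochschild_diff mu (hochschild_diff mu al) = 0.
Proof.
(* The default values of [inord] past the last index are never read. *)
apply: cochainP => a; pose b n := a (inord n).
have -> : a = (fun j => b j) by apply/funext => j; rewrite /b inord_val.
rewrite cochain_zeroE -/(eval_seq _ b) hochschild_diff_coface.
have -> : eval_seq (hochschild_diff mu al) =
    fun b' => (-1) ^+ p *: \sum_(i < p.+3) (-1) ^+ i *: coface p i (eval_seq al) b'.
  by apply/funext => b'; rewrite hochschild_diff_coface.
under eq_bigr => j _ do rewrite coface_sum scalerA mulrC -scalerA.
rewrite -scaler_sumr
  (@alternating_cosimplicial_sum _ _ p.+3
     (fun j i => coface p.+1 j (coface p i (eval_seq al)) b)) ?scaler0 //.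
by move=> i j; apply: coface_coface.
Qed.

End Cofaces.

(** * Curvature and differential of the tangent complex *)

Section TangentComplex.
Variables (R : comNzRingType) (V : lmodType R) (gr : posGrading V).
Variable mu : cochain gr 1.

Lemma hochschild_diffE p (al : cochain gr p) :
  hochschild_diff mu al = twisted_diff mu al.
Proof. exact/val_inj/hochschild_funE. Qed.

(** Reconciles the [addnC] inside [bracket] with the [erefl] inside [curvature]. *)
Lemma circ_arity n p q (e e' : n = (p + q)%N) (al : cochain gr p) (be : cochain gr q) :
  circ e al be = circ e' al be.
Proof. by rewrite (eq_irrelevance e e'). Qed.

Lemma curvature_associative : associative (product mu) -> curvature mu = 0.
Proof.
move=> muA; apply: cochainP => a; rewrite cochain_zeroE circE.
rewrite big_ord_recl big_ord1 /= mul0n mul1n expr0 scale1r scaleN1r.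
pose a0 := a (inord 0); pose a1 := a (inord 1); pose a2 := a (inord 2).
transitivity (product mu (product mu a0 a1) a2 - product mu a0 (product mu a1 a2)).
  congr (_ - _); congr (cochain_fun mu _); apply/funext => -[[|[|k]] kP] //=;
  rewrite /insert /=; congr (cochain_fun mu _); apply/funext => -[[|[|l]] lP] //=.
by rewrite muA subrr.
Qed.

Lemma tangent_diffE p (al : cochain gr p) : tangent_diff mu al = twisted_diff mu al.
Proof.
case: p al => [|[|p]] al //=.
  apply: cochainP => a; rewrite /twisted_diff /bracket.
  rewrite !(cochain_addE, cochain_oppE, cochain_scaleE) infinitesimal_actionE.
  (* As [al] has degree 0, all signs in both composites are 1. *)
  rewrite muln0 expr0 scale1r opprB !circE big_ord1 mul0n expr0 scale1r.
  congr (_ - _).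
    apply: eq_bigr => j _; rewrite muln0 expr0 scale1r insertP.
    congr (cochain_fun mu _); apply/funext => k; rewrite /upd /insert.
    case: eqVneq => [_|kj].
      by congr (cochain_fun al _); apply/funext => l; rewrite ord1 addn0 inord_val.
    have /negPf-> : (k != j :> nat) by [].
    by rewrite addn0 inord_val; case: ifP.
  congr (cochain_fun al _); apply/funext => j; rewrite /insert ord1 /=.
  congr (cochain_fun mu _); apply/funext => k; rewrite add0n inord_val //.
(* For two elements of degree 1 the bracket is the symmetric sum. *)
rewrite curvature_derivativeE /twisted_diff /bracket muln1 expr1 scaleN1r opprK.
by congr (_ + _); apply: circ_arity.
Qed.

End TangentComplex.

(** * Comparing cohomology in a single pair of degrees *)

Section CohomologyIso.
Variables (R : pzRingType) (C C' : cochainSeq R) (i j : nat).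
Variables (f : {linear cobj C i -> cobj C' j}) (g : cobj C' j -> cobj C i).
Hypotheses (fK : cancel f g) (gK : cancel g f).
Hypothesis f_cocycle : forall x, (cdiff C' j (f x) == 0) = (cdiff C i x == 0).
Hypothesis f_coboundary : forall x, is_coboundary (f x) <-> is_coboundary x.

(** A linear bijection matching cocycles and coboundaries passes to the quotients; no chain map in
    other degrees is involved. *)
Lemma cohomology_iso :
  exists phi : {linear cohomology C i -> cohomology C' j},
    bijective phi /\
    forall (z : cocycle C i) (w : cocycle C' j),
      f (cocycle_val z) = cocycle_val w -> phi (cclass z) = cclass w.
Proof.
have fP (z : cocycle C i) : f (cocycle_val z) \in @cocycle_pred _ C' j.
  by case: z => x zP; rewrite unfold_in /= f_cocycle.
pose F z := Cocycle (fP z).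
pose phi (h : cohomology C i) : cohomology C' j := cclass (F (repr h)).
(* One equivalence gives both independence of the representative and injectivity. *)
have eq_class (x y : cocycle C i) (x' y' : cocycle C' j) :
    f (cocycle_val x) = cocycle_val x' -> f (cocycle_val y) = cocycle_val y' ->
    (cclass x' == cclass y') = (cclass x == cclass y).
  move=> xx' yy'; rewrite !cclass_eq !unfold_in.
  have -> : cocycle_val (x' - y') = f (cocycle_val (x - y)).
    by rewrite [RHS]linearB xx' yy'.
  exact: asbool_equiv_eq (f_coboundary _).
have phiE (z : cocycle C i) (w : cocycle C' j) :
    f (cocycle_val z) = cocycle_val w -> phi (cclass z) = cclass w.
  by move=> zw; apply/eqP; rewrite (eq_class (repr (cclass z)) z) // cclassK.
have phiL : linear phi.
  move=> c h k; rewrite -[h]cclassK -[k]cclassK.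
  set x := repr _; set y := repr _.
  rewrite -[c *: cclass x]/(cohomology_scale c _) cohomology_scaleE -cclassD.
  rewrite (phiE x (F x)) // (phiE y (F y)) //.
  rewrite -[c *: cclass (F x)]/(cohomology_scale c _) cohomology_scaleE -cclassD.
  by apply: phiE; rewrite [LHS]linearP.
pose Phi := HB.pack_for {linear cohomology C i -> cohomology C' j} phi
  (GRing.isLinear.Build _ _ _ _ phi phiL).
exists Phi; split=> [|z w]; last exact: phiE.
have gP (w : cocycle C' j) : g (cocycle_val w) \in @cocycle_pred _ C i.
  by case: w => x wP; rewrite unfold_in /= -f_cocycle gK.
pose psi (h : cohomology C' j) : cohomology C i := cclass (Cocycle (gP (repr h))).
have phi_psi : cancel psi phi.
  by move=> h; rewrite (phiE _ (repr h)) ?cclassK //= gK.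
exists psi => //; apply: inj_can_sym phi_psi _ => h k.
rewrite -[h]cclassK -[k]cclassK => /eqP hk; apply/eqP; move: hk.
by rewrite (phiE _ (F (repr h))) // (phiE _ (F (repr k))) // (eq_class (repr h) (repr k)).
Qed.

End CohomologyIso.

(** * The tangent and Hochschild complexes compared *)

Theorem mainTheorem2 (K : fieldType) (charK0 : [pchar K] =i pred0)
    (V : lmodType K) (gr : posGrading V) (Vfin : locally_finite gr)
    (mu : cochain gr 1) (muA : associative (product mu)) :
  [/\ curvature mu = 0,
      (is_complex (tangent_complex mu) /\ is_complex (hochschild_complex mu)),
      (forall p (al : cochain gr p),
         cdiff (tangent_complex mu) p al = cdiff (twisted_complex mu) p al),
      (forall p (al : cochain gr p),
         cdiff (tangent_complex mu) p al = cdiff (hochschild_complex mu) p.+1 al)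
    & forall i : nat,
        exists phi : {linear cohomology (tangent_complex mu) i -> HHgr mu i.+1},
          bijective phi /\
          forall (z : cocycle (tangent_complex mu) i)
                 (w : cocycle (hochschild_complex mu) i.+1),
            cocycle_val z = cocycle_val w :> cochain gr i ->
            phi (cclass z) = cclass w].
Proof.
have tangentE p (al : cochain gr p) :
    tangent_diff mu al = hochschild_diff mu al.
  by rewrite tangent_diffE hochschild_diffE.
split=> //.
- exact: curvature_associative.
- split=> [p x|[|p] x] /=; last exact: hochschild_diff_diff.
    suff: tangent_diff mu (tangent_diff mu x) = 0 by [].
    by rewrite !tangentE hochschild_diff_diff.
  exact: linear0.
- by move=> p al; apply: tangent_diffE.
move=> i.
pose f : {linear cochain gr i -> cochain gr i} := idfun.
apply: (@cohomology_iso _ (tangent_complex mu) (hochschild_complex mu) i i.+1 f id) => // x.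
  by rewrite /= tangentE.
(* For [i = 0] the convention that coboundaries vanish agrees with the image of the zero map out of
   Hochschild degree 0. *)
case: i @f x => [|i] f x /=; split=> [[y ->]|] //.
- by move=> ->; exists 0.
- by exists y; rewrite tangentE.
- by move=> [y ->]; exists y; rewrite tangentE.
Qed.
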